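(* Let $\mathcal{C}$ be a category and $S\in\boldsymbol{\sigma}\text{-}\mathcal{C}$. If $\mathcal{C}$ has finite limits and countable products, then the forgetful functor $$\lfloor\,\rfloor_S^{\mathrm{Corr}}:(\boldsymbol{\sigma}\text{-}\mathcal{C})_{/S}\to\mathrm{Corr}_S,$$ which sends an object $X\to S$ to the $S$-correspondence $X\xleftarrow{\mathrm{id}}X\xrightarrow{\sigma_X}X$, admits a right adjoint $|\,\cdot\,\rceil_S$.
   Context: $\boldsymbol{\sigma}\text{-}\mathcal{C}$ is the category of pairs $(X,\sigma_X)$ with $X\in\mathcal{C}$, $\sigma_X\in\mathcal{C}(X,X)$, and morphisms commuting with the $\sigma$'s; $\lfloor\,\rfloor$ is the forgetful functor to $\mathcal{C}$; $(\boldsymbol{\sigma}\text{-}\mathcal{C})_{/S}$ is the slice category over $S$. $\mathrm{Corr}_S=\mathrm{Corr}_S(\mathcal{C})$ is the category of self-$S$-correspondences in $\mathcal{C}$: an object $(X_0;C_0)$ consists of objects $X_0\to\lfloor S\rfloor$ and $C_0\to\lfloor S\rfloor$ over $\lfloor S\rfloor$ together with $\mathcal{C}$-morphisms $p_0:C_0\to X_0$ lying over $\mathrm{id}:\lfloor S\rfloor\to\lfloor S\rfloor$ and $\sigma_0:C_0\to X_0$ lying over $\sigma_S:\lfloor S\rfloor\to\lfloor S\rfloor$ (i.e. the evident squares commute). A morphism $(X_0;C_0)\to(Y_0;D_0)$ consists of $\mathcal{C}$-morphisms $f_0:X_0\to Y_0$ and $\hat f_0:C_0\to D_0$ over $\lfloor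 S\rfloor$ such that $p_0\hat f_0=f_0p_0$ and $\sigma_0\hat f_0=f_0\sigma_0$. *)

(* Defs.v *)
From Stdlib Require Import FinFun ProofIrrelevance.

Set Implicit Arguments.
Unset Strict Implicit.
Unset Printing Implicit Defensive.

Declare Scope cat_scope.
Delimit Scope cat_scope with cat.
Local Open Scope cat_scope.

(** Morphisms are compared by Leibniz equality; subtypes of morphisms cut out
    by equations rely on proof irrelevance. *)

Record category := Category {
  ob :> Type;
  hom : ob -> ob -> Type;
  idm : forall x, hom x x;
  comp : forall x y z, hom y z -> hom x y -> hom x z;
  comp_idl : forall x y (f : hom x y), comp (idm y) f = f;
  comp_idr : forall x y (f : hom x y), comp f (idm x) = f;
  comp_assoc : forall x y z t (h : hom z t) (g : hom y z) (f : hom x y),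
    comp h (comp g f) = comp (comp h g) f
}.

Arguments hom {c} x y.
Arguments idm {c} x.
Arguments comp {c x y z} g f.
Arguments comp_idl {c x y} f.
Arguments comp_idr {c x y} f.
Arguments comp_assoc {c x y z t} h g f.

Notation "g ∘ f" := (comp g f) (at level 40, left associativity) : cat_scope.

Record functor (C D : category) := Functor {
  fob :> C -> D;
  fmap : forall x y : C, hom x y -> hom (fob x) (fob y);
  fmap_id : forall x : C, fmap (idm x) = idm (fob x);
  fmap_comp : forall (x y z : C) (g : hom y z) (f : hom x y),
    fmap (g ∘ f) = fmap g ∘ fmap f
}.

Arguments fmap {C D} _ {x y} _.

Definition is_right_adjoint (C D : category) (F : functor C D) (G : functor D C)
    : Prop :=
  exists phi : forall (x : C) (y : D), hom (F x) y -> hom x (G y),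
    (forall x y, Bijective (phi x y)) /\
    (forall (x x' : C) (y y' : D) (h : hom x' x) (f : hom (F x) y) (g : hom y y'),
       phi x' y' (g ∘ f ∘ fmap F h) = fmap G g ∘ phi x y f ∘ h).

Definition has_right_adjoint (C D : category) (F : functor C D) : Prop :=
  exists G : functor D C, is_right_adjoint F G.

Definition is_cone (J C : category) (F : functor J C) (L : C)
    (p : forall j : J, hom L (F j)) : Prop :=
  forall (i j : J) (u : hom i j), fmap F u ∘ p i = p j.

Definition is_limit (J C : category) (F : functor J C) (L : C)
    (p : forall j : J, hom L (F j)) : Prop :=
  is_cone p /\
  forall (Z : C) (q : forall j : J, hom Z (F j)), is_cone q ->
    exists! m : hom Z L, forall j : J, p j ∘ m = q j.

Definition finite_category (J : category) : Prop :=
  Finite J /\ forall i j : J, Finite (hom i j).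

Definition has_finite_limits (C : category) : Prop :=
  forall (J : category) (F : functor J C), finite_category J ->
    exists (L : C) (p : forall j : J, hom L (F j)), is_limit p.

Definition is_product (C : category) (I : Type) (X : I -> C) (P : C)
    (p : forall i : I, hom P (X i)) : Prop :=
  forall (Z : C) (q : forall i : I, hom Z (X i)),
    exists! m : hom Z P, forall i : I, p i ∘ m = q i.

(** Finite and empty types included. *)
Definition countable (I : Type) : Prop := exists f : I -> nat, Injective f.

Definition has_countable_products (C : category) : Prop :=
  forall (I : Type) (X : I -> C), countable I ->
    exists (P : C) (p : forall i : I, hom P (X i)), is_product p.

Record slice_ob (C : category) (S : C) := SliceOb {
  total :> C;
  arr : hom total S
}.

Record slice_hom (C : category) (S : C) (X Y : slice_ob S) := SliceHom {
  smap :> hom X Y;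
  smapP : arr Y ∘ smap = arr X
}.

Lemma slice_hom_eq (C : category) (S : C) (X Y : slice_ob S)
    (f g : slice_hom X Y) : smap f = smap g -> f = g.
Proof.
destruct f as [f Hf], g as [g Hg]; simpl; intros ->.
now rewrite (proof_irrelevance _ Hf Hg).
Qed.

Definition slice_id (C : category) (S : C) (X : slice_ob S) : slice_hom X X :=
  SliceHom (comp_idr (arr X)).

Definition slice_comp (C : category) (S : C) (X Y Z : slice_ob S)
    (g : slice_hom Y Z) (f : slice_hom X Y) : slice_hom X Z.
Proof.
refine (@SliceHom C S X Z (smap g ∘ smap f) _).
abstract (now rewrite comp_assoc, !smapP).
Defined.

Definition slice (C : category) (S : C) : category.
Proof.
refine (@Category (slice_ob S) (@slice_hom C S) (@slice_id C S)
          (@slice_comp C S) _ _ _);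
abstract (intros; apply slice_hom_eq; simpl;
          auto using comp_idl, comp_idr, comp_assoc).
Defined.

Record sigma_ob (C : category) := SigmaOb {
  carrier : C;
  sigma : hom carrier carrier
}.

Record sigma_hom (C : category) (X Y : sigma_ob C) := SigmaHom {
  umap :> hom (carrier X) (carrier Y);
  umapP : umap ∘ sigma X = sigma Y ∘ umap
}.

Lemma sigma_hom_eq (C : category) (X Y : sigma_ob C) (f g : sigma_hom X Y) :
  umap f = umap g -> f = g.
Proof.
destruct f as [f Hf], g as [g Hg]; simpl; intros ->.
now rewrite (proof_irrelevance _ Hf Hg).
Qed.

Definition sigma_id (C : category) (X : sigma_ob C) : sigma_hom X X.
Proof.
refine (@SigmaHom C X X (idm (carrier X)) _).
abstract (now rewrite comp_idl, comp_idr).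
Defined.

Definition sigma_comp (C : category) (X Y Z : sigma_ob C)
    (g : sigma_hom Y Z) (f : sigma_hom X Y) : sigma_hom X Z.
Proof.
refine (@SigmaHom C X Z (umap g ∘ umap f) _).
abstract (now rewrite <- comp_assoc, umapP, comp_assoc, umapP, <- comp_assoc).
Defined.

Definition sigma_cat (C : category) : category.
Proof.
refine (@Category (sigma_ob C) (@sigma_hom C) (@sigma_id C) (@sigma_comp C) _ _ _);
abstract (intros; apply sigma_hom_eq; simpl;
          auto using comp_idl, comp_idr, comp_assoc).
Defined.

Definition forget (C : category) : functor (sigma_cat C) C :=
  @Functor (sigma_cat C) C (@carrier C) (fun X Y f => umap f)
    (fun X => eq_refl) (fun X Y Z g f => eq_refl).

Definition lies_over (C : category) (S T : C) (b : hom S T)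
    (X : slice_ob S) (Y : slice_ob T) (f : hom X Y) : Prop :=
  arr Y ∘ f = b ∘ arr X.

(** The self-S-correspondence (X_0; C_0), with X_0 = [corr_base],
    C_0 = [corr_corr], p_0 = [corr_p] and sigma_0 = [corr_sigma].  As sigma_0
    lies over sigma_S rather than over the identity, [corr_p] and [corr_sigma]
    are both morphisms of C between the total objects, not slice morphisms. *)
Record corr_ob (C : category) (S : sigma_cat C) := CorrOb {
  corr_base : slice (forget C S);
  corr_corr : slice (forget C S);
  corr_p : hom (total corr_corr) (total corr_base);
  corr_sigma : hom (total corr_corr) (total corr_base);
  corr_pP : lies_over (idm (forget C S)) corr_p;
  corr_sigmaP : lies_over (sigma S) corr_sigma
}.

Record corr_hom (C : category) (S : sigma_cat C) (X Y : corr_ob S) := CorrHom {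
  cmap : hom (corr_base X) (corr_base Y);
  chat : hom (corr_corr X) (corr_corr Y);
  corr_hom_p : corr_p Y ∘ smap chat = smap cmap ∘ corr_p X;
  corr_hom_sigma : corr_sigma Y ∘ smap chat = smap cmap ∘ corr_sigma X
}.

Lemma corr_hom_eq (C : category) (S : sigma_cat C) (X Y : corr_ob S)
    (f g : corr_hom X Y) : cmap f = cmap g -> chat f = chat g -> f = g.
Proof.
destruct f as [f f' Hf Hf'], g as [g g' Hg Hg']; simpl; intros -> ->.
now rewrite (proof_irrelevance _ Hf Hg), (proof_irrelevance _ Hf' Hg').
Qed.

Definition corr_id (C : category) (S : sigma_cat C) (X : corr_ob S) :
  corr_hom X X.
Proof.
refine (@CorrHom C S X X (idm (corr_base X)) (idm (corr_corr X)) _ _);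
abstract (simpl; now rewrite comp_idl, comp_idr).
Defined.

Definition corr_comp (C : category) (S : sigma_cat C) (X Y Z : corr_ob S)
    (g : corr_hom Y Z) (f : corr_hom X Y) : corr_hom X Z.
Proof.
refine (@CorrHom C S X Z (cmap g ∘ cmap f) (chat g ∘ chat f) _ _).
- abstract (generalize (corr_hom_p g) (corr_hom_p f); simpl; intros Hg Hf;
    now rewrite comp_assoc, Hg, <- !comp_assoc, Hf).
- abstract (generalize (corr_hom_sigma g) (corr_hom_sigma f); simpl; intros Hg Hf;
    now rewrite comp_assoc, Hg, <- !comp_assoc, Hf).
Defined.

Definition corr (C : category) (S : sigma_cat C) : category.
Proof.
refine (@Category (corr_ob S) (@corr_hom C S) (@corr_id C S) (@corr_comp C S) _ _ _);
abstract (intros; apply corr_hom_eq; apply slice_hom_eq; simpl;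
          auto using comp_idl, comp_idr, comp_assoc).
Defined.

Definition forget_slice_ob (C : category) (S : sigma_cat C)
    (X : slice S) : slice (forget C S) :=
  SliceOb (fmap (forget C) (arr X)).

Definition forget_slice_hom (C : category) (S : sigma_cat C)
    (X Y : slice S) (f : hom X Y) :
    hom (forget_slice_ob X) (forget_slice_ob Y) :=
  @SliceHom C (forget C S) (forget_slice_ob X) (forget_slice_ob Y)
    (fmap (forget C) (smap f)) (f_equal (@umap C _ _) (smapP f)).

Definition forget_corr_ob (C : category) (S : sigma_cat C) (X : slice S) :
  corr S.
Proof.
refine (@CorrOb C S (forget_slice_ob X) (forget_slice_ob X)
          (idm (carrier (total X))) (sigma (total X)) _ _).
- abstract (unfold lies_over; now rewrite comp_idl, comp_idr).
- abstract (exact (umapP (arr X))).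
Defined.

Definition forget_corr_hom (C : category) (S : sigma_cat C) (X Y : slice S)
    (f : hom X Y) : hom (forget_corr_ob X) (forget_corr_ob Y).
Proof.
refine (@CorrHom C S (forget_corr_ob X) (forget_corr_ob Y)
          (forget_slice_hom f) (forget_slice_hom f) _ _).
- abstract (simpl; now rewrite comp_idl, comp_idr).
- abstract (simpl; exact (eq_sym (umapP (smap f)))).
Defined.

Definition forget_corr (C : category) (S : sigma_cat C) :
  functor (slice S) (corr S).
Proof.
refine (@Functor (slice S) (corr S) (@forget_corr_ob C S)
          (@forget_corr_hom C S) _ _);
abstract (intros; apply corr_hom_eq; apply slice_hom_eq; reflexivity).
Defined.

(* Main.v *)
From Stdlib Require Import FinFun ClassicalEpsilon.
Require Import Defs.

Set Implicit Arguments.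
Unset Strict Implicit.
Unset Printing Implicit Defensive.

Local Open Scope cat_scope.

(** A right adjoint amounts to a universal arrow from the forgetful functor to
    each correspondence, so fix [(X_0; C_0)] with legs [p_0] and [sigma_0].

    A morphism of correspondences from [(Z <-id- Z -sigma-> Z)] to [(X_0; C_0)]
    is determined by its component [g : Z -> C_0], since the other one must be
    [p_0 g]; the condition left on [g] is [sigma_0 g = p_0 g sigma_Z].  Write
    [g_n = g sigma_Z^n].  Then [sigma_0 g_n = p_0 g_(n+1)] for all [n], so [g]
    yields a map from [Z] to the object [E] of sequences [(c_0, c_1, ...)] in
    [C_0] with [sigma_0 c_n = p_0 c_(n+1)], that is, of infinite walks along the
    correspondence.  This [E] is the equalizer of two maps from the countable
    power of [C_0] to that of [X_0] ([walk_object_exists]).  Deleting the first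
    step of a walk is an endomorphism of [E], and a map [Z -> E] commutes with
    the endomorphisms exactly when its components have the form [g sigma_Z^n].
    Hence [E] with the shift is the value of the right adjoint
    ([walk_object_universal]).

    The structure map of [E] over [S] is that of [c_0].  Since [p_0] lies over
    the identity and [sigma_0] over [sigma_S], the equations of a walk force
    [c_n] to lie over [sigma_S^n] applied to the image of [c_0], so the shift
    is compatible with [sigma_S]. *)

(** * Right adjoints from universal arrows *)

Definition is_universal_arrow (C D : category) (F : functor C D) (Y : D)
    (G : C) (eps : hom (F G) Y) : Prop :=
  forall (Z : C) (f : hom (F Z) Y), exists! h : hom Z G, eps ∘ fmap F h = f.

(** Transposition sends [f : F Z -> Y] to its unique factorization through
    the universal arrow to [Y]; functoriality and naturality both follow from
    uniqueness of factorizations. *)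
Lemma right_adjoint_of_universal_arrows (C D : category) (F : functor C D) :
  (forall Y : D, exists (G : C) (eps : hom (F G) Y), is_universal_arrow eps) ->
  has_right_adjoint F.
Proof.
intros H.
pose (Gob := fun Y => proj1_sig (constructive_indefinite_description _ (H Y))).
assert (Heps : forall Y, exists eps : hom (F (Gob Y)) Y, is_universal_arrow eps).
{ intros Y; exact (proj2_sig (constructive_indefinite_description _ (H Y))). }
clearbody Gob.
pose (eps := fun Y => proj1_sig (constructive_indefinite_description _ (Heps Y))).
assert (Huniv : forall Y, is_universal_arrow (eps Y)).
{ intros Y; exact (proj2_sig (constructive_indefinite_description _ (Heps Y))). }
clearbody eps.
assert (Hex : forall Z Y (f : hom (F Z) Y), exists h, eps Y ∘ fmap F h = f).
{ intros Z Y f; destruct (Huniv Y Z f) as [h [Hh _]]; eauto. }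
pose (phi := fun Z Y f =>
  proj1_sig (constructive_indefinite_description _ (Hex Z Y f))).
assert (Hphi : forall Z Y f, eps Y ∘ fmap F (phi Z Y f) = f).
{ intros Z Y f.
  exact (proj2_sig (constructive_indefinite_description _ (Hex Z Y f))). }
clearbody phi.
assert (Hinj : forall Z Y (h h' : hom Z (Gob Y)),
  eps Y ∘ fmap F h = eps Y ∘ fmap F h' -> h = h').
{ intros Z Y h h' E; destruct (Huniv Y Z (eps Y ∘ fmap F h')) as [k [_ Hk]].
  now rewrite <- (Hk h E), <- (Hk h' eq_refl). }
unshelve eexists (@Functor D C Gob (fun Y Y' g => phi _ _ (g ∘ eps Y)) _ _).
- intros Y; apply Hinj.
  now rewrite Hphi, fmap_id, comp_idl, comp_idr.
- intros X Y Z g f; apply Hinj.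
  rewrite Hphi, fmap_comp, (comp_assoc (eps Z)), Hphi.
  now rewrite <- (comp_assoc g (eps Y)), Hphi, comp_assoc.
- exists phi; split.
  + intros Z Y; exists (fun h => eps Y ∘ fmap F h); split; intros f.
    * apply Hphi.
    * apply Hinj, Hphi.
  + intros Z Z' Y Y' h f g; simpl; apply Hinj.
    rewrite Hphi, !fmap_comp, !(comp_assoc (eps Y')), Hphi.
    now rewrite <- (comp_assoc g (eps Y)), Hphi.
Qed.

(** * Equalizers as finite limits *)

Definition is_equalizer (C : category) (A B : C) (f g : hom A B) (E : C)
    (e : hom E A) : Prop :=
  f ∘ e = g ∘ e /\
  forall (Z : C) (q : hom Z A), f ∘ q = g ∘ q -> exists! m : hom Z E, e ∘ m = q.

(** In the walking parallel pair, [false] is the source and [true] the target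
    of the two arrows, which are themselves indexed by [bool]. *)
Definition pair_hom (i j : bool) : Type :=
  match i, j with
  | false, true => bool
  | true, false => Empty_set
  | _, _ => unit
  end.

Definition pair_id (i : bool) : pair_hom i i :=
  match i with false => tt | true => tt end.

Definition pair_comp (i j k : bool) :
    pair_hom j k -> pair_hom i j -> pair_hom i k :=
  match i, j, k with
  | false, false, false | true, true, true => fun _ _ => tt
  | false, false, true => fun g _ => g
  | false, true, true => fun _ f => f
  | false, true, false | true, true, false => fun g _ => match g with end
  | true, false, _ => fun _ f => match f with end
  end.

Definition walking_pair : category.
Proof.
refine (@Category bool pair_hom pair_id pair_comp _ _ _).
- intros [] []; simpl; intros []; reflexivity.
- intros [] []; simpl; intros []; reflexivity.
- intros [] [] [] []; simpl; intros [] [] []; reflexivity.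
Defined.

Lemma walking_pair_finite : finite_category walking_pair.
Proof.
split.
- exists (cons true (cons false nil)); intros []; simpl; auto.
- intros [] [].
  + exists (cons tt nil); intros []; simpl; auto.
  + exists nil; intros [].
  + exists (cons true (cons false nil)); intros []; simpl; auto.
  + exists (cons tt nil); intros []; simpl; auto.
Qed.

Definition pair_functor (C : category) (A B : C) (f g : hom A B) :
  functor walking_pair C.
Proof.
pose (F0 := fun i : bool => if i then B else A).
pose (F1 := fun i j : bool =>
  match i, j return pair_hom i j -> hom (F0 i) (F0 j) with
  | false, false => fun _ => idm A
  | true, true => fun _ => idm B
  | false, true => fun b : bool => if b then f else g
  | true, false => fun u => match u with end
  end).
refine (@Functor walking_pair C F0 F1 _ _).
- intros []; reflexivity.
- intros [] [] []; simpl; intros [] []; simpl;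
    now rewrite ?comp_idl, ?comp_idr.
Defined.

Lemma equalizer_exists (C : category) (A B : C) (f g : hom A B) :
  has_finite_limits C -> exists (E : C) (e : hom E A), is_equalizer f g e.
Proof.
intros HC.
destruct (HC _ (pair_functor f g) walking_pair_finite) as [L [p [Hp HL]]].
exists L, (p false); split.
- transitivity (p true).
  + exact (Hp false true true).
  + symmetry; exact (Hp false true false).
- intros Z q Hq.
  pose (r := fun j : bool =>
    match j return hom Z (pair_functor f g j) with
    | false => q
    | true => f ∘ q
    end).
  assert (Hr : @is_cone walking_pair C (pair_functor f g) Z r).
  { intros [] [] []; simpl; rewrite ?comp_idl; auto. }
  destruct (HL Z r Hr) as [m [Hm Hu]].
  exists m; split; [exact (Hm false) |].
  intros m' Hm'; apply Hu; intros []; [| exact Hm'].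
  (* The leg at the target is recovered from the leg at the source. *)
  rewrite <- (Hp false true true); simpl.
  now rewrite <- comp_assoc, Hm'.
Qed.

(** * The object of walks *)

Definition is_walk (C : category) (A B : C) (p s : hom A B) (Z : C)
    (q : nat -> hom Z A) : Prop :=
  forall n, s ∘ q n = p ∘ q (S n).

Definition is_walk_object (C : category) (A B : C) (p s : hom A B) (E : C)
    (c : nat -> hom E A) : Prop :=
  is_walk p s c /\
  forall (Z : C) (q : nat -> hom Z A), is_walk p s q ->
    exists! m : hom Z E, forall n, c n ∘ m = q n.

(** The [n]-th components of the two equalized maps of countable powers are
    [s] applied to the [n]-th coordinate and [p] applied to the next one. *)
Lemma walk_object_exists (C : category) (A B : C) (p s : hom A B) :
  has_finite_limits C -> has_countable_products C ->
  exists (E : C) (c : nat -> hom E A), is_walk_object p s c.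
Proof.
intros HL HP.
assert (Hnat : countable nat) by (exists (fun n => n); intros n m; auto).
destruct (HP nat (fun _ => A) Hnat) as [PA [a Ha]].
destruct (HP nat (fun _ => B) Hnat) as [PB [b Hb]].
destruct (Hb PA (fun n => s ∘ a n)) as [u [Hu _]].
destruct (Hb PA (fun n => p ∘ a (S n))) as [v [Hv _]].
destruct (equalizer_exists u v HL) as [E [e [He HE]]].
exists E, (fun n => a n ∘ e); split.
- intros n; now rewrite !comp_assoc, <- Hu, <- Hv, <- !comp_assoc, He.
- intros Z q Hq.
  destruct (Ha Z q) as [r [Hr Hru]].
  assert (Huv : u ∘ r = v ∘ r).
  { destruct (Hb Z (fun n => s ∘ q n)) as [w [_ Hw]].
    transitivity w; [symmetry |]; apply Hw; intros n.
    - now rewrite comp_assoc, Hu, <- comp_assoc, Hr.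
    - now rewrite comp_assoc, Hv, <- comp_assoc, Hr, Hq. }
  destruct (HE Z r Huv) as [m [Hm Hmu]].
  exists m; split.
  + intros n; now rewrite <- comp_assoc, Hm.
  + intros m' Hm'; apply Hmu; symmetry; apply Hru.
    intros n; now rewrite comp_assoc.
Qed.

Lemma walk_object_shift (C : category) (A B : C) (p s : hom A B) (E : C)
    (c : nat -> hom E A) :
  is_walk_object p s c -> exists t : hom E E, forall n, c n ∘ t = c (S n).
Proof.
intros [Hc HE].
destruct (HE E (fun n => c (S n)) (fun n => Hc (S n))) as [t [Ht _]].
now exists t.
Qed.

Fixpoint iter_hom (C : category) (Z : C) (s : hom Z Z) (n : nat) : hom Z Z :=
  match n with
  | 0 => idm Z
  | S n => s ∘ iter_hom s n
  end.

Lemma iter_hom_comm (C : category) (Z : C) (s : hom Z Z) n :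
  iter_hom s n ∘ s = s ∘ iter_hom s n.
Proof.
induction n as [| n IH]; simpl.
- now rewrite comp_idl, comp_idr.
- now rewrite <- comp_assoc, IH.
Qed.

(** Cofreeness of the walk object: an equivariant map into it is the same thing
    as its first step [g], subject to the equation that makes the sequence
    [g ∘ s ^ n] a walk.  Equivariance turns the shift into precomposition with
    the endomorphism of [Z], which is why the later steps are determined. *)
Lemma walk_object_cofree (C : category) (A B : C) (p s : hom A B) (E : C)
    (c : nat -> hom E A) (t : hom E E) (Z : C) (z : hom Z Z) (g : hom Z A) :
  is_walk_object p s c -> (forall n, c n ∘ t = c (S n)) ->
  s ∘ g = p ∘ g ∘ z ->
  exists! m : hom Z E, m ∘ z = t ∘ m /\ c 0 ∘ m = g.
Proof.
intros [Hc HE] Ht Hg.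
assert (Hw : is_walk p s (fun n => g ∘ iter_hom z n)).
{ intros n; simpl; now rewrite !comp_assoc, Hg. }
destruct (HE Z _ Hw) as [m [Hm Hu]].
exists m; split; [split |].
- assert (Hw' : is_walk p s (fun n => g ∘ iter_hom z (S n))).
  { intros n; exact (Hw (S n)). }
  destruct (HE Z _ Hw') as [m' [_ Hu']].
  transitivity m'; [symmetry |]; apply Hu'; intros n.
  + now rewrite comp_assoc, Hm, <- comp_assoc, iter_hom_comm.
  + now rewrite comp_assoc, Ht, Hm.
- rewrite Hm; apply comp_idr.
- intros m' [Hz H0]; apply Hu; intros n.
  induction n as [| n IH]; simpl.
  + now rewrite H0, comp_idr.
  + now rewrite <- Ht, <- comp_assoc, <- Hz, comp_assoc, IH, <- comp_assoc,
      iter_hom_comm.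
Qed.

(** * The right adjoint *)

(** A walk object lies over [S] through its first step, and the shift lies over
    [sigma_S] because the second step is linked to the first by [sigma_0] and
    [p_0].  The counit is the first step, together with its image under
    [p_0]. *)
Lemma walk_object_universal (C : category) (S : sigma_cat C) (Y : corr S)
    (E : C) (c : nat -> hom E (total (corr_corr Y))) :
  is_walk_object (corr_p Y) (corr_sigma Y) c ->
  exists (G : slice S) (eps : hom (forget_corr S G) Y), is_universal_arrow eps.
Proof.
intros HE.
destruct (walk_object_shift HE) as [t Ht].
pose proof (corr_pP Y) as HpS; pose proof (corr_sigmaP Y) as HsS.
unfold lies_over in HpS, HsS; rewrite comp_idl in HpS.
assert (Harr : arr (corr_corr Y) ∘ c 0 ∘ t
             = sigma S ∘ (arr (corr_corr Y) ∘ c 0)).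
{ rewrite <- comp_assoc, Ht, comp_assoc, <- HsS, <- HpS at 1.
  now rewrite <- !comp_assoc, <- (proj1 HE 0). }
pose (G := @SliceOb (sigma_cat C) S (SigmaOb t)
             (@SigmaHom C (SigmaOb t) S (arr (corr_corr Y) ∘ c 0) Harr)).
assert (Hbase : arr (corr_base Y) ∘ (corr_p Y ∘ c 0)
              = arr (corr_corr Y) ∘ c 0).
{ now rewrite comp_assoc, HpS. }
pose (eps0 := @SliceHom C (forget C S) (forget_slice_ob G) (corr_base Y)
                (corr_p Y ∘ c 0) Hbase).
pose (eps1 := @SliceHom C (forget C S) (forget_slice_ob G) (corr_corr Y)
                (c 0) eq_refl).
assert (Hp : corr_p Y ∘ smap eps1 = smap eps0 ∘ corr_p (forget_corr S G)).
{ symmetry; apply comp_idr. }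
assert (Hs : corr_sigma Y ∘ smap eps1
           = smap eps0 ∘ corr_sigma (forget_corr S G)).
{ simpl; rewrite <- comp_assoc, Ht; apply (proj1 HE). }
exists G, (@CorrHom C S (forget_corr S G) Y eps0 eps1 Hp Hs).
intros Z f.
(* The component on [X_0] is [p_0] composed with the one on [C_0]. *)
assert (Hf : smap (cmap f) = corr_p Y ∘ smap (chat f)).
{ symmetry; rewrite (corr_hom_p f); apply comp_idr. }
assert (Hg : corr_sigma Y ∘ smap (chat f)
           = corr_p Y ∘ smap (chat f) ∘ sigma (total Z)).
{ rewrite <- Hf; exact (corr_hom_sigma f). }
destruct (walk_object_cofree HE Ht Hg) as [m [[Hm Hm0] Hu]].
assert (Hover : arr (corr_corr Y) ∘ c 0 ∘ m = umap (arr Z)).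
{ rewrite <- comp_assoc, Hm0; exact (smapP (chat f)). }
pose (ms := @SigmaHom C (total Z) (total G) m Hm : hom (total Z) (total G)).
assert (Hms : arr G ∘ ms = arr Z) by (apply sigma_hom_eq; exact Hover).
exists (@SliceHom (sigma_cat C) S Z G ms Hms).
split.
- apply corr_hom_eq; apply slice_hom_eq; simpl.
  + rewrite <- comp_assoc.
    exact (eq_trans (f_equal (comp (corr_p Y)) Hm0) (eq_sym Hf)).
  + exact Hm0.
- intros h Hh; apply slice_hom_eq, sigma_hom_eq; simpl.
  apply Hu; split.
  + exact (umapP (smap h)).
  + exact (f_equal (fun k => smap (chat k)) Hh).
Qed.

Theorem proposition2p26 (C : category) (S : sigma_cat C) :
  has_finite_limits C -> has_countable_products C ->
  has_right_adjoint (forget_corr S).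
Proof.
intros HL HP; apply right_adjoint_of_universal_arrows; intros Y.
destruct (walk_object_exists (corr_p Y) (corr_sigma Y) HL HP) as [E [c HE]].
exact (walk_object_universal HE).
Qed.
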